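(* Suppose $\mathscr F^2=\mathrm{id}$ and $(A,B,C)$ scales. Define $L_w$ inductively on words $w$ on $\{0,1\}$ by $L_0=A$, $L_1=B$, $$L_{w0}=\begin{cases}\alpha^{k+1}(B)&\text{if }L_w=\alpha^k(A)\\ \alpha^k(C)&\text{if }L_w=\alpha^k(B)\\ \alpha^k(A)&\text{if }L_w=\alpha^k(C)\end{cases}\qquad\text{and}\qquad L_{w1}=\begin{cases}\alpha^{k}(C)&\text{if }L_w=\alpha^k(A)\\ \alpha^{k-1}(A)&\text{if }L_w=\alpha^k(B)\\ \alpha^k(B)&\text{if }L_w=\alpha^k(C).\end{cases}$$ Then $L_w$ is a coherent choice of tensors, i.e. $\mathscr D(L_{w0},L_{w1})=\mathscr Y(L_w)$ for each word $w$, so the $L_w$ determine a scale invariant transfer matrix: $T^L_t\circ\iota_s^t=\iota_s^t\circ T^L_s$ for all $s\le t$ in $\mathfrak T$.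
   Context: $\mathfrak h$ is a (usually finite dimensional) Hilbert space with a fixed orthonormal basis $(e_i)$ used to write tensors in components, and $Y:\mathfrak h\to\mathfrak h\otimes\mathfrak h$ is a linear isometry, $Y e_b=\sum_{x,y}Y_{b,x,y}\,e_x\otimes e_y$, which is invariant under rotation: $Y_{i,j,k}=Y_{j,k,i}$. Elements of $\otimes^4\mathfrak h$ are written by components $A_{i,j,k,\ell}$ (legs north, east, south, west). The space $\otimes^4\mathfrak h$ is a unital associative algebra under the multiplication $(AB)_{i,j,k,\ell}=\sum_{p,q}A_{i,p,q,\ell}B_{p,j,k,q}$ and under the ''comultiplication'' $(A.B)_{i,j,k,\ell}=\sum_{p,q}A_{p,q,k,\ell}B_{i,j,q,p}$. $X^{-1}$ is the inverse for multiplication, $X^\tau$ the inverse for comultiplication, and $\mathscr F$ is the rotation by $\pi/2$: $\mathscr F(A)_{i,j,k,\ell}=A_{\ell,i,j,k}$. Put $\alpha(X)=\mathscr F^{-1}(X^{-1})$ with domain $\{X:X^{-1}\text{ exists}\}$ and $\beta(X)=\mathscr F(X^\tau)$ with domain $\{X:X^\tau\text{ exists}\}$; $\beta$ is the inverse of the partially defined map $\alpha$, so $\alpha^{-n}=\beta^n$ for $n>0$. The tensors $\mathscr D(A,B),\mathscr Y(C)\in\otimes^5\mathfrak h$ are $$\mathscr D(A,B)_{b,w,n_1,n_2,e}=\sum_{x,y,m}Y_{b,x,y}\,A_{n_1,m,x,w}\,B_{n_2,e,y,m},\qquad \mathscr Y(C)_{b,w,n_1,n_2,e}=\sum_p C_{p,e,b,w}\,Y_{p,n_1,n_2}.$$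 The ABC equation is $\mathscr D(A,B)=\mathscr Y(C)$. $(A,B,C)$ ''scales'' if it satisfies the ABC equation and $A,B,C\in\mathrm{Dom}(\alpha^n)$ for all $n\in\mathbb Z$. $\mathfrak T$ is the directed set of planar binary rooted trees, $s\le t$ iff $s$ is a rooted subtree of $t$. For $t$ with $k$ leaves $\mathcal H_t=\otimes^k\mathfrak h$; if $t$ is obtained from $s$ by a binary branching at the $i$-th leaf, $\iota_s^t=\mathrm{id}^{\otimes(i-1)}\otimes Y\otimes\mathrm{id}^{\otimes(k-i)}$ ($k$ the number of leaves of $s$), and general $\iota_s^t$ are compositions of these. Each leaf is coded by the word on $\{0,1\}$ read along the path from root to leaf ($0$ left, $1$ right). At the empty word $L$ takes the value $C$ (so that the rule with $L_w=C$, $k=0$ gives $L_0=A$, $L_1=B$). If the leaves of $t$ from left to right have words $w_1,\dots,w_k$ then $T^L_t=T(L_{w_1},\dots,L_{w_k})$, where $$T(L_1,\dots,L_k)(e_{s_1}\otimes\cdots\otimes e_{s_k})=\sum_{n_1,\dots,n_k}\ \sum_{v_1,\dots,v_k}\ \prod_{i=1}^k (L_i)_{n_i,\,v_{i+1},\,s_i,\,v_i}\ e_{n_1}\otimes\cdots\otimes e_{n_k},\quad v_{k+1}:=v_1 .$$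
   Formalization: F²=id on all of ⊗⁴h forces dim h≤1; there the claim is proved as printed. If F² only fixes A,B,C, the printed shifts are false (example: h=C³, Y=ε/√2), so it is proved with L_{w0}=α^{k-1}(B) for L_w=α^k(A) and L_{w1}=α^{k+1}(A) for L_w=α^k(B). *)

(* Defs.v *)
From HB Require Import structures.
From mathcomp Require Import all_boot all_order all_algebra.
From mathcomp Require Import complex.
From mathcomp Require Import boolp classical_sets reals.

Set Implicit Arguments.
Unset Strict Implicit.
Unset Printing Implicit Defensive.

Import Order.TTheory GRing.Theory Num.Theory.
Local Open Scope ring_scope.
Local Open Scope complex_scope.

(* The Hilbert space h is the complex space with orthonormal basis
   (e_i)_(i < n); it is finite dimensional because the two algebra structures
   on its fourth tensor power are required to be unital. *)

(* The k-th tensor power of h, in components. *)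
Definition tens (R : realType) (n k : nat) : Type :=
  {ffun k.-tuple 'I_n -> R[i]}.

Definition sqnorm (R : realType) (n k : nat) (x : tens R n k) : R[i] :=
  \sum_(w : k.-tuple 'I_n) `|x w| ^+ 2.

Definition tens3 (R : realType) (n : nat) : Type :=
  {ffun 'I_n * 'I_n * 'I_n -> R[i]}.

(* Legs in the order north, east, south, west. *)
Definition tens4 (R : realType) (n : nat) : Type :=
  {ffun 'I_n * 'I_n * 'I_n * 'I_n -> R[i]}.

Definition tens5 (R : realType) (n : nat) : Type :=
  {ffun 'I_n * 'I_n * 'I_n * 'I_n * 'I_n -> R[i]}.

(* id^(i) (x) Y (x) id^(k - i - 1), where Y e_b = sum_(x, y) Y_(b,x,y) e_x (x) e_y
   and i counts from 0.  The input word is w with its entry i + 1 deleted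
   (that is what [lift (lift ord0 i)] skips) and its entry i replaced by b. *)
Definition apply_Y (R : realType) (n : nat) (Y : tens3 R n) (k : nat) (i : 'I_k)
    (x : tens R n k) : tens R n k.+1 :=
  [ffun w : k.+1.-tuple 'I_n =>
    \sum_(b < n) Y (b, tnth w (widen_ord (leqnSn k) i), tnth w (lift ord0 i)) *
      x [tuple if j == i then b else tnth w (lift (lift ord0 i) j) | j < k]].

(* For k = 1, i = 0, [apply_Y] is Y itself, as a map from h to h (x) h. *)
Definition isometry_Y (R : realType) (n : nat) (Y : tens3 R n) : Prop :=
  forall x : tens R n 1, sqnorm (apply_Y Y ord0 x) = sqnorm x.

Definition rotation_invariant (R : realType) (n : nat) (Y : tens3 R n) : Prop :=
  forall i j k : 'I_n, Y (i, j, k) = Y (j, k, i).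

Section FourTensors.
Variables (R : realType) (n : nat).
Implicit Types (A B C X Z : tens4 R n) (Y : tens3 R n).

Definition tmul A B : tens4 R n :=
  [ffun t : 'I_n * 'I_n * 'I_n * 'I_n => let '(i, j, k, l) := t in
    \sum_(p < n) \sum_(q < n) A (i, p, q, l) * B (p, j, k, q)].

Definition tone : tens4 R n :=
  [ffun t : 'I_n * 'I_n * 'I_n * 'I_n => let '(i, j, k, l) := t in
    ((i == j) && (k == l))%:R : R[i]].

Definition tcomul A B : tens4 R n :=
  [ffun t : 'I_n * 'I_n * 'I_n * 'I_n => let '(i, j, k, l) := t in
    \sum_(p < n) \sum_(q < n) A (p, q, k, l) * B (i, j, q, p)].

Definition tcoone : tens4 R n :=
  [ffun t : 'I_n * 'I_n * 'I_n * 'I_n => let '(i, j, k, l) := t in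
    ((i == l) && (j == k))%:R : R[i]].

Definition quarter_turn A : tens4 R n :=
  [ffun t : 'I_n * 'I_n * 'I_n * 'I_n => let '(i, j, k, l) := t in
    A (l, i, j, k)].

Definition quarter_turn_inv A : tens4 R n :=
  [ffun t : 'I_n * 'I_n * 'I_n * 'I_n => let '(i, j, k, l) := t in
    A (j, k, l, i)].

Definition is_inverse X Z : Prop := tmul X Z = tone /\ tmul Z X = tone.

Definition is_coinverse X Z : Prop := tcomul X Z = tcoone /\ tcomul Z X = tcoone.

Definition dom_alpha X : Prop := exists Z, is_inverse X Z.

Definition dom_beta X : Prop := exists Z, is_coinverse X Z.

(* [alpha] and [beta] are total, with junk values outside their domains. *)
Definition alpha X : tens4 R n := quarter_turn_inv (xget X [set Z | is_inverse X Z]%classic).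

Definition beta X : tens4 R n := quarter_turn (xget X [set Z | is_coinverse X Z]%classic).

(* alpha^k for k : int, with alpha^(-m) = beta^m; [Negz m] is - (m + 1). *)
Definition alpha_pow (k : int) X : tens4 R n :=
  match k with
  | Posz m => iter m alpha X
  | Negz m => iter m.+1 beta X
  end.

Definition dom_alpha_pow (k : int) X : Prop :=
  match k with
  | Posz m => forall j, (j < m)%N -> dom_alpha (iter j alpha X)
  | Negz m => forall j, (j < m.+1)%N -> dom_beta (iter j beta X)
  end.

Definition scrD Y A B : tens5 R n :=
  [ffun t : 'I_n * 'I_n * 'I_n * 'I_n * 'I_n => let '(b, w, n1, n2, e) := t in
    \sum_(x < n) \sum_(y < n) \sum_(m < n)
      Y (b, x, y) * A (n1, m, x, w) * B (n2, e, y, m)].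

Definition scrY Y C : tens5 R n :=
  [ffun t : 'I_n * 'I_n * 'I_n * 'I_n * 'I_n => let '(b, w, n1, n2, e) := t in
    \sum_(p < n) C (p, e, b, w) * Y (p, n1, n2)].

Definition ABC_equation Y A B C : Prop := scrD Y A B = scrY Y C.

Definition scales Y A B C : Prop :=
  ABC_equation Y A B C /\
  forall k : int, [/\ dom_alpha_pow k A, dom_alpha_pow k B & dom_alpha_pow k C].

End FourTensors.

(* Words on {0, 1}: false is 0, true is 1, and the head of the list is the first
   letter, so that w0 is [rcons w false] and w1 is [rcons w true]. *)
Definition word : Type := seq bool.

Definition coherent (R : realType) (n : nat) (Y : tens3 R n)
    (L : word -> tens4 R n) : Prop :=
  forall w : word, scrD Y (L (rcons w false)) (L (rcons w true)) = scrY Y (L w).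

(* The letter and the exponent k of L_w = alpha^k(A), alpha^k(B) or alpha^k(C)
   are carried along the induction: the tensor L_w alone need not determine
   them. *)
Inductive letter : Type := LetA | LetB | LetC.

Definition next_state (s : letter * int) (d : bool) : letter * int :=
  match s, d with
  | (LetA, k), false => (LetB, k + 1)
  | (LetB, k), false => (LetC, k)
  | (LetC, k), false => (LetA, k)
  | (LetA, k), true => (LetC, k)
  | (LetB, k), true => (LetA, k - 1)
  | (LetC, k), true => (LetB, k)
  end.

(* [next_state] with the shifts + 1 and - 1 exchanged.  When the squared rotation
   fixes A, B and C, the ABC equation is equivalent both to
   D(alpha^-1(B), C) = Y(A) and to D(C, alpha(A)) = Y(B); these are the
   exponents used here.  Those of [next_state] agree with them only when alpha^2
   acts trivially, for instance if the squared rotation is the identity on all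
   of the fourth tensor power of h. *)
Definition next_state_opp (s : letter * int) (d : bool) : letter * int :=
  match s, d with
  | (LetA, k), false => (LetB, k - 1)
  | (LetB, k), false => (LetC, k)
  | (LetC, k), false => (LetA, k)
  | (LetA, k), true => (LetC, k)
  | (LetB, k), true => (LetA, k + 1)
  | (LetC, k), true => (LetB, k)
  end.

Definition tensor_of_state (R : realType) (n : nat) (A B C : tens4 R n)
    (s : letter * int) : tens4 R n :=
  alpha_pow s.2 (match s.1 with LetA => A | LetB => B | LetC => C end).

Definition Lword (R : realType) (n : nat) (A B C : tens4 R n) (w : word) :
    tens4 R n :=
  tensor_of_state A B C (foldl next_state (LetC, 0) w).

Definition Lword_opp (R : realType) (n : nat) (A B C : tens4 R n) (w : word) :
    tens4 R n :=
  tensor_of_state A B C (foldl next_state_opp (LetC, 0) w).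

Inductive tree : Type := Leaf | Node of tree & tree.

Fixpoint subtree (s t : tree) : bool :=
  match s, t with
  | Leaf, _ => true
  | Node s1 s2, Node t1 t2 => subtree s1 t1 && subtree s2 t2
  | Node _ _, Leaf => false
  end.

Fixpoint leaf_words (t : tree) : seq word :=
  match t with
  | Leaf => [:: [::]]
  | Node l r => map (cons false) (leaf_words l) ++ map (cons true) (leaf_words r)
  end.

Definition nleaves (t : tree) : nat := size (leaf_words t).

(* Binary branching at leaf i, counted from 0 (at the last leaf if i is out of
   range). *)
Fixpoint branch (t : tree) (i : nat) : tree :=
  match t with
  | Leaf => Node Leaf Leaf
  | Node l r => if (i < nleaves l)%N then Node (branch l i) r
                else Node l (branch r (i - nleaves l))
  end.

Lemma nleaves_node (l r : tree) : nleaves (Node l r) = (nleaves l + nleaves r)%N.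
Proof. by rewrite /nleaves /= size_cat !size_map. Qed.

Lemma nleaves_branch (t : tree) (i : nat) : nleaves (branch t i) = (nleaves t).+1.
Proof.
elim: t i => [|l IHl r IHr] i //=.
by case: ifP => _; rewrite !nleaves_node ?IHl ?IHr ?addSn ?addnS.
Qed.

Definition cast_tens (R : realType) (n k l : nat) (e : k = l) (x : tens R n k) :
    tens R n l :=
  [ffun w : l.-tuple 'I_n => x (tcast (esym e) w)].

Definition iota_branch (R : realType) (n : nat) (Y : tens3 R n) (t : tree)
    (i : 'I_(nleaves t)) (x : tens R n (nleaves t)) :
    tens R n (nleaves (branch t i)) :=
  cast_tens (esym (nleaves_branch t i)) (apply_Y Y i x).

(* [is_iota Y f]: f is a composition of elementary maps along a sequence of
   branchings from s to t. *)
Inductive is_iota (R : realType) (n : nat) (Y : tens3 R n) (s : tree) :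
    forall t : tree, (tens R n (nleaves s) -> tens R n (nleaves t)) -> Prop :=
| is_iota_id : is_iota Y (fun x : tens R n (nleaves s) => x)
| is_iota_branch (t : tree) (f : tens R n (nleaves s) -> tens R n (nleaves t))
    (i : 'I_(nleaves t)) :
    is_iota Y f -> is_iota Y (fun x => iota_branch Y i (f x)).

(* T(L_1, ..., L_k); [ordS] is the cyclic successor, whence v_(k+1) = v_1. *)
Definition transfer (R : realType) (n k : nat) (L : k.-tuple (tens4 R n))
    (x : tens R n k) : tens R n k :=
  [ffun u : k.-tuple 'I_n =>
    \sum_(s : k.-tuple 'I_n)
      (\sum_(v : k.-tuple 'I_n)
        \prod_(i < k) tnth L i (tnth u i, tnth v (ordS i), tnth s i, tnth v i)) *
      x s].

Definition transfer_tree (R : realType) (n : nat) (L : word -> tens4 R n)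
    (t : tree) : tens R n (nleaves t) -> tens R n (nleaves t) :=
  transfer (map_tuple L (in_tuple (leaf_words t))).

Definition scale_invariant (R : realType) (n : nat) (Y : tens3 R n)
    (L : word -> tens4 R n) : Prop :=
  forall s t : tree, subtree s t ->
  forall f : tens R n (nleaves s) -> tens R n (nleaves t), is_iota Y f ->
  forall x : tens R n (nleaves s),
    transfer_tree L (f x) = f (transfer_tree L x).

(* The maps quantified over in [scale_invariant] exist for all s <= t. *)
Section IotaExists.
Variables (R : realType) (n : nat) (Y : tens3 R n).

Let linked (s t : tree) : Prop :=
  exists f : tens R n (nleaves s) -> tens R n (nleaves t), is_iota Y f.

Let linked_refl s : linked s s.
Proof. by eexists; apply: is_iota_id. Qed.

Let linked_branch s t (i : nat) : (i < nleaves t)%N -> linked s t ->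
  linked s (branch t i).
Proof.
by move=> hi [f hf]; eexists; apply: (is_iota_branch (Ordinal hi) hf).
Qed.

Let linked_ind s (P : tree -> Prop) : P s ->
  (forall t i, (i < nleaves t)%N -> P t -> P (branch t i)) ->
  forall t, linked s t -> P t.
Proof. by move=> P0 PS t [f]; elim=> // {}t {}f i _; apply: PS. Qed.

Let linked_trans s t u : linked s t -> linked t u -> linked s u.
Proof.
move=> st; move: u; apply: linked_ind => // u i hi; exact: linked_branch.
Qed.

Let linked_nodel r s t : linked s t -> linked (Node s r) (Node t r).
Proof.
move: t; apply: linked_ind => // t i hi h.
have := @linked_branch _ (Node t r) i _ h; rewrite /= hi; apply.
by rewrite nleaves_node ltn_addr.
Qed.

Let linked_noder l s t : linked s t -> linked (Node l s) (Node l t).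
Proof.
move: t; apply: linked_ind => // t i hi h.
have e : branch (Node l t) (nleaves l + i) = Node l (branch t i).
  by rewrite /= ltnNge leq_addr /= addKn.
by rewrite -e; apply: linked_branch h; rewrite nleaves_node ltn_add2l.
Qed.

Lemma is_iota_exists (s t : tree) : subtree s t ->
  exists f : tens R n (nleaves s) -> tens R n (nleaves t), is_iota Y f.
Proof.
rewrite -/(linked s t).
elim: t s => [|t1 IH1 t2 IH2] [|s1 s2] //=.
- move=> _; apply: (@linked_trans _ (Node Leaf Leaf)).
    exact: (@linked_branch Leaf Leaf 0).
  by apply: (linked_trans (linked_nodel _ (IH1 Leaf _)))
            (linked_noder _ (IH2 Leaf _)).
- case/andP=> h1 h2.
  exact: (linked_trans (linked_nodel _ (IH1 _ h1)) (linked_noder _ (IH2 _ h2))).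
Qed.

End IotaExists.

(* Main.v *)
Require Import Defs.
From mathcomp Require Import all_boot all_order all_algebra.
From mathcomp Require Import complex reals ring.
From mathcomp Require Import classical_sets.

(** Two facts give the theorem: the ABC equation can be rotated about the
    trivalent vertex Y, and a coherent choice of tensors is, leaf by leaf, what
    lets the transfer matrix slide through a branching.

    Rotating the ABC equation.  In D(A, B) = Y(C) the three tensors sit around
    Y.  Contracting both sides with the inverse of A carries A to the other
    side; if C and B are unchanged by the half turn F^2, and Y by rotation, what
    results is again an ABC equation, D(C, alpha(A)) = Y(B)
    ([ABC_move_left]).  Contracting with the coinverse of B gives
    D(alpha^-1(B), C) = Y(A) in the same way ([ABC_move_right]).  Applying the
    first move three times replaces (A, B, C) by
    (alpha(A), alpha(B), alpha(C)), and the second move three times does the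
    same with alpha^-1, so all three equations hold with every power of alpha
    applied throughout ([ABC_orbits]).  These three families are exactly the
    coherence conditions at the words whose state is C, A or B, for the shifts
    of [next_state_opp].  The half turn reverses products, so it commutes with
    taking inverses; this is why invariance of A, B, C under it passes to all
    their powers ([alpha_orbit_half_turn]).

    If F^2 fixes the whole fourth tensor power, comparing the entries of
    e_i (x) e_i (x) e_j (x) e_j with those of its half turn shows that the basis
    has at most one vector.  Then F is the identity and alpha is inversion, which
    has period two ([alpha_orbit_periodic]), so the shifts + 1 and - 1 agree and
    [next_state] is coherent as well.

    From coherence to scale invariance.  It suffices to treat one branching, at
    leaf i.  The transfer matrix of the larger tree differs from that of the
    smaller one only near that leaf: it has one more input index, one more
    vertical bond, and the two tensors L_(w0), L_(w1) in place of L_w.  Summing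
    over the input indices and the bond at that leaf produces the left-hand
    side D(L_(w0), L_(w1)) composed with Y, and coherence turns it into
    Y(L_w) ([transfer_branch]). *)

Set Implicit Arguments.
Unset Strict Implicit.
Unset Printing Implicit Defensive.

Import GRing.Theory.
Local Open Scope ring_scope.
Local Open Scope complex_scope.

(** * Inverses, coinverses and rotation *)

Section Rotation.
Variables (R : realType) (n : nat).
Implicit Types A B X Z : tens4 R n.

Lemma tmulE A B i j k l :
  tmul A B (i, j, k, l) =
  \sum_(p < n) \sum_(q < n) A (i, p, q, l) * B (p, j, k, q).
Proof. by rewrite ffunE. Qed.

Lemma quarter_turnE A i j k l : quarter_turn A (i, j, k, l) = A (l, i, j, k).
Proof. by rewrite ffunE. Qed.

Lemma tens4_eqP A B :
  (forall i j k l, A (i, j, k, l) = B (i, j, k, l)) -> A = B.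
Proof. by move=> AB; apply/ffunP => -[[[i j] k] l]; apply: AB. Qed.

Lemma quarter_turnK : cancel (@quarter_turn R n) (@quarter_turn_inv R n).
Proof. by move=> A; apply: tens4_eqP => i j k l; rewrite !ffunE. Qed.

Lemma quarter_turn_invK : cancel (@quarter_turn_inv R n) (@quarter_turn R n).
Proof. by move=> A; apply: tens4_eqP => i j k l; rewrite !ffunE. Qed.

(** The rotation carries the legs contracted by the comultiplication to those
    contracted by the multiplication, with the factors in the opposite order;
    inverses being two-sided, it therefore turns coinverses into inverses. *)
Lemma quarter_turn_comul A B :
  quarter_turn (tcomul A B) = tmul (quarter_turn B) (quarter_turn A).
Proof.
apply: tens4_eqP => i j k l; rewrite tmulE !ffunE exchange_big /=.
by do 2!apply: eq_bigr => ? _; rewrite !quarter_turnE mulrC.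
Qed.

Lemma quarter_turn_coone : quarter_turn (tcoone R n) = tone R n.
Proof. by apply: tens4_eqP => i j k l; rewrite !ffunE eq_sym andbC eq_sym. Qed.

Lemma half_turn_mul A B :
  quarter_turn (quarter_turn (tmul A B)) =
  tmul (quarter_turn (quarter_turn B)) (quarter_turn (quarter_turn A)).
Proof.
apply: tens4_eqP => i j k l; rewrite !quarter_turnE !tmulE exchange_big /=.
by do 2!apply: eq_bigr => ? _; rewrite !quarter_turnE mulrC.
Qed.

Lemma half_turn_one : quarter_turn (quarter_turn (tone R n)) = tone R n.
Proof. by apply: tens4_eqP => i j k l; rewrite !ffunE andbC. Qed.

(** The product is that of matrices with rows indexed by (north, west) and columns
    by (east, south). *)
Lemma tmulA A B X : tmul A (tmul B X) = tmul (tmul A B) X.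
Proof.
apply: tens4_eqP => i j k l; rewrite !tmulE.
rewrite pair_bigA [RHS]pair_bigA /=.
under eq_bigr => t _ do rewrite tmulE pair_bigA mulr_sumr.
under [RHS]eq_bigr => t _ do rewrite tmulE pair_bigA mulr_suml.
by rewrite exchange_big; do 2!apply: eq_bigr => ? _; rewrite mulrA.
Qed.

Lemma sum_delta (m : nat) (f : 'I_m -> R[i]) (j : 'I_m) :
  \sum_(i < m) f i * (i == j)%:R = f j.
Proof.
rewrite (bigD1 j) //= eqxx mulr1 big1 ?addr0 // => i /negPf ->.
by rewrite mulr0.
Qed.

Lemma tmul1t A : tmul (tone R n) A = A.
Proof.
apply: tens4_eqP => i j k l; rewrite tmulE.
rewrite -[RHS](sum_delta (fun p => A (p, j, k, l))); apply: eq_bigr => p _.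
rewrite -[in RHS](sum_delta (fun q => A (p, j, k, q))) mulr_suml.
apply: eq_bigr => q _; rewrite ffunE (eq_sym i) mulrC andbC -mulrA -natrM.
by rewrite mulnb.
Qed.

Lemma tmult1 A : tmul A (tone R n) = A.
Proof.
apply: tens4_eqP => i j k l; rewrite tmulE.
rewrite -[RHS](sum_delta (fun p => A (i, p, k, l))); apply: eq_bigr => p _.
rewrite -[in RHS](sum_delta (fun q => A (i, p, q, l))) mulr_suml.
apply: eq_bigr => q _; rewrite ffunE (eq_sym k) andbC -mulrA -natrM.
by rewrite mulnb.
Qed.

Lemma is_inverse_sym X Z : is_inverse X Z -> is_inverse Z X.
Proof. by case. Qed.

Lemma is_inverse_unique X Z Z' : is_inverse X Z -> is_inverse X Z' -> Z = Z'.
Proof.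
by move=> [_ ZX] [XZ' _]; rewrite -[LHS]tmult1 -XZ' tmulA ZX tmul1t.
Qed.

(** As the half turn reverses products, the half turn of an inverse of X is again
    an inverse of X; inverses being unique, it is the same tensor. *)
Lemma half_turn_inverse X Z : is_inverse X Z ->
  quarter_turn (quarter_turn X) = X -> quarter_turn (quarter_turn Z) = Z.
Proof.
move=> h hX; apply: is_inverse_unique (h); case: h => XZ ZX.
by split; rewrite -hX -half_turn_mul ?XZ ?ZX half_turn_one.
Qed.

Lemma coinverse_quarter_turn X Z :
  is_coinverse X Z -> is_inverse (quarter_turn Z) (quarter_turn X).
Proof.
by case=> XZ ZX; split; rewrite -quarter_turn_comul ?XZ ?ZX quarter_turn_coone.
Qed.

Lemma alpha_inverse X : dom_alpha X -> is_inverse X (quarter_turn (alpha X)).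
Proof. by move=> hX; rewrite quarter_turn_invK; exact: (xgetPex X hX). Qed.

Lemma beta_inverse X : dom_beta X -> is_inverse (beta X) (quarter_turn X).
Proof. by move=> hX; apply: coinverse_quarter_turn; exact: (xgetPex X hX). Qed.

(** A two-sided orbit of the partial map alpha.  A single relation between
    consecutive terms serves both directions: it says that a (k + 1) is
    alpha (a k), and equivalently, as the rotation exchanges the two products,
    that a k is beta (a (k + 1)). *)
Definition alpha_orbit (a : int -> tens4 R n) : Prop :=
  forall k, is_inverse (a k) (quarter_turn (a (k + 1))).

Lemma alpha_orbit_pred a : alpha_orbit a ->
  forall k, is_inverse (a (k - 1)) (quarter_turn (a k)).
Proof. by move=> ha k; have := ha (k - 1); rewrite subrK. Qed.

Lemma alpha_pow_orbit X :
  (forall k, dom_alpha_pow k X) -> alpha_orbit (fun k => alpha_pow k X).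
Proof.
move=> hX [m|m].
  rewrite -PoszD addn1 /=; apply: alpha_inverse.
  exact: (hX (Posz m.+1)).
have -> : Negz m + 1 = - (m%:Z) by rewrite NegzE -addn1 PoszD opprD addrNK.
have -> : alpha_pow (- m%:Z) X = iter m (@beta R n) X.
  by case: m => //= m; rewrite -NegzE.
by apply: beta_inverse; exact: (hX (Negz m)).
Qed.

(** Invariance spreads from a 0 in both directions, since a k and the quarter turn
    of a (k + 1) are inverse to each other. *)
Lemma alpha_orbit_half_turn a : alpha_orbit a ->
  quarter_turn (quarter_turn (a 0)) = a 0 ->
  forall k, quarter_turn (quarter_turn (a k)) = a k.
Proof.
move=> ha h0; elim/int_ind => // m IH.
- rewrite -addn1 PoszD; apply: (can_inj quarter_turnK).
  exact: half_turn_inverse (ha m) IH.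
- have := ha (- m.+1%:Z); rewrite -addn1 PoszD opprD addrNK => /is_inverse_sym.
  by move/half_turn_inverse; apply; rewrite IH.
Qed.

(** The half turn takes e_i (x) e_i (x) e_j (x) e_j to
    e_j (x) e_j (x) e_i (x) e_i, so fixing it forces i = j. *)
Lemma half_turn_trivial :
  (forall X : tens4 R n, quarter_turn (quarter_turn X) = X) ->
  forall i j : 'I_n, i = j.
Proof.
move=> h i j; apply/eqP.
have := congr1 (fun X : tens4 R n => X (i, i, j, j))
  (h [ffun t => (t == (i, i, j, j))%:R]).
rewrite /= !ffunE eqxx !xpair_eqE; case: (i == j) (j == i) => [] [] //=.
all: by move=> /eqP; rewrite eq_sym oner_eq0.
Qed.

(** Over at most one basis vector every rotation is the identity, so a (k + 1) and
    a (k - 1) are both inverse to a k. *)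
Lemma alpha_orbit_periodic a :
  (forall X : tens4 R n, quarter_turn (quarter_turn X) = X) ->
  alpha_orbit a -> forall k, a (k + 1) = a (k - 1).
Proof.
move=> /half_turn_trivial eqI ha k.
have qt X : quarter_turn X = X.
  apply: tens4_eqP => i j l m; rewrite quarter_turnE.
  by rewrite (eqI j i) (eqI l i) (eqI m i).
have := ha k; have := ha (k - 1); rewrite subrK !qt => /is_inverse_sym h h'.
exact: is_inverse_unique h' h.
Qed.

End Rotation.

(** * Rotating the ABC equation *)

Section ABC.
Variables (R : realType) (n : nat) (Y : tens3 R n).
Hypothesis Y_rot : rotation_invariant Y.
Implicit Types A B C : tens4 R n.

Lemma ABC_entries A B C : ABC_equation Y A B C <->
  forall b w n1 n2 e,
    \sum_(x < n) \sum_(y < n) \sum_(m < n)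
       Y (b, x, y) * A (n1, m, x, w) * B (n2, e, y, m)
    = \sum_(p < n) C (p, e, b, w) * Y (p, n1, n2).
Proof.
split=> [h b w n1 n2 e | h].
  by have := congr1 (fun T : tens5 R n => T (b, w, n1, n2, e)) h; rewrite !ffunE.
by apply/ffunP => -[[[[b w] n1] n2] e]; rewrite !ffunE.
Qed.

Lemma half_turn_entries A i j k l : quarter_turn (quarter_turn A) = A ->
  A (i, j, k, l) = A (k, l, i, j).
Proof. by move=> h; rewrite -[in LHS]h !quarter_turnE. Qed.

Lemma exchange_sums (F : 'I_n -> 'I_n -> 'I_n -> 'I_n -> 'I_n -> R[i]) :
  \sum_y \sum_m \sum_x \sum_z \sum_q F y m x z q =
  \sum_x \sum_z \sum_q \sum_y \sum_m F y m x z q.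
Proof.
rewrite pair_bigA exchange_big /=; apply: eq_bigr => x _.
rewrite exchange_big; apply: eq_bigr => z _ /=.
rewrite exchange_big; apply: eq_bigr => q _ /=.
by rewrite pair_bigA.
Qed.

(** Contract the ABC equation with the inverse of A, which is the quarter turn of
    A' = alpha(A).  In the new equation, the contraction of Y with C on
    its left is, up to rotating Y and a half turn of C, the right-hand side of
    the ABC equation; replacing it by D(A, B) brings A next to its inverse, and
    the two cancel. *)
Lemma ABC_move_left A A' B C :
  quarter_turn (quarter_turn B) = B -> quarter_turn (quarter_turn C) = C ->
  is_inverse A (quarter_turn A') ->
  ABC_equation Y A B C -> ABC_equation Y C A' B.
Proof.
move=> hB hC [_ A'A] /ABC_entries abc; apply/ABC_entries => b w n1 n2 e.
transitivity (\sum_(y < n) \sum_(m < n) A' (n2, e, y, m) *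
    \sum_(x < n) C (x, w, n1, m) * Y (x, y, b)).
  rewrite exchange_big; apply: eq_bigr => y _ /=.
  rewrite exchange_big; apply: eq_bigr => m _ /=.
  rewrite mulr_sumr; apply: eq_bigr => x _.
  by rewrite (Y_rot b) (half_turn_entries n1 _ _ _ hC); ring.
(* This contraction is an entry of the product of the quarter turn of A' with A,
   that is, of the identity. *)
have eA m x : \sum_(y < n) \sum_(q < n) A' (n2, e, y, q) * A (y, m, x, q) =
    (m == e)%:R * (x == n2)%:R.
  have := congr1 (fun X : tens4 R n => X (e, m, x, n2)) A'A.
  rewrite tmulE ffunE eq_sym -natrM mulnb => <-.
  by do 2!apply: eq_bigr => ? _; rewrite quarter_turnE.
transitivity (\sum_(x < n) \sum_(z < n) \sum_(q < n)
    Y (n1, x, z) * B (b, w, z, q) * ((q == e)%:R * (x == n2)%:R)).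
  under eq_bigr => y _.
    under eq_bigr => m _.
      rewrite -abc mulr_sumr.
      under eq_bigr => x _.
        rewrite mulr_sumr.
        under eq_bigr => z _ do rewrite mulr_sumr.
        over.
      over.
    over.
  rewrite exchange_sums; do 3!apply: eq_bigr => ? _.
  rewrite -eA mulr_sumr; apply: eq_bigr => ? _.
  rewrite mulr_sumr; apply: eq_bigr => ? _.
  by ring.
rewrite exchange_big; apply: eq_bigr => z _ /=.
under eq_bigr => x _ do under eq_bigr => q _ do rewrite mulrA.
under eq_bigr => x _ do rewrite -mulr_suml sum_delta.
by rewrite sum_delta (half_turn_entries _ _ _ _ hB) mulrC (Y_rot z) (Y_rot n1).
Qed.

(** The mirror image of [ABC_move_left]: B' = alpha^-1(B) is the quarter turn of
    the coinverse of B, and B' cancels B. *)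
Lemma ABC_move_right A B B' C :
  quarter_turn (quarter_turn A) = A -> quarter_turn (quarter_turn C) = C ->
  is_inverse B' (quarter_turn B) ->
  ABC_equation Y A B C -> ABC_equation Y B' C A.
Proof.
move=> hA hC [B'B _] /ABC_entries abc; apply/ABC_entries => b w n1 n2 e.
transitivity (\sum_(m < n) \sum_(x < n) B' (n1, m, x, w) *
    \sum_(y < n) C (y, m, n2, e) * Y (y, b, x)).
  rewrite [RHS]exchange_big; apply: eq_bigr => x _ /=.
  rewrite exchange_big; apply: eq_bigr => m _ /=.
  rewrite mulr_sumr; apply: eq_bigr => y _.
  by rewrite (half_turn_entries n2 _ _ _ hC) -(Y_rot y); ring.
have eB m y : \sum_(q < n) \sum_(x < n) B' (n1, q, x, w) * B (x, q, y, m) =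
    (m == w)%:R * (y == n1)%:R.
  have := congr1 (fun X : tens4 R n => X (n1, y, m, w)) B'B.
  rewrite tmulE ffunE (eq_sym n1) andbC -natrM mulnb => <-.
  by do 2!apply: eq_bigr => ? _; rewrite quarter_turnE.
transitivity (\sum_(z < n) \sum_(y < n) \sum_(q < n)
    Y (n2, z, y) * A (b, q, z, e) * ((q == w)%:R * (y == n1)%:R)).
  under eq_bigr => y _.
    under eq_bigr => m _.
      rewrite -abc mulr_sumr.
      under eq_bigr => x _.
        rewrite mulr_sumr.
        under eq_bigr => z _ do rewrite mulr_sumr.
        over.
      over.
    over.
  rewrite exchange_sums; do 3!apply: eq_bigr => ? _.
  rewrite -eB mulr_sumr; apply: eq_bigr => ? _.
  rewrite mulr_sumr; apply: eq_bigr => ? _.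
  by ring.
apply: eq_bigr => z _.
under eq_bigr => y _ do under eq_bigr => q _ do rewrite mulrA.
under eq_bigr => y _ do rewrite -mulr_suml sum_delta.
by rewrite sum_delta (half_turn_entries _ _ _ _ hA) mulrC (Y_rot n2).
Qed.

(** Moving left three times, (A, B, C), (C, alpha A, B), (B, alpha C, alpha A),
    restores the order of the letters with alpha applied to each; moving right
    three times does the same with its inverse.  This shifts k by one in either
    direction, and the last two equations are single moves from the first. *)
Lemma ABC_orbits a b c : alpha_orbit a -> alpha_orbit b -> alpha_orbit c ->
  quarter_turn (quarter_turn (a 0)) = a 0 ->
  quarter_turn (quarter_turn (b 0)) = b 0 ->
  quarter_turn (quarter_turn (c 0)) = c 0 ->
  ABC_equation Y (a 0) (b 0) (c 0) ->
  forall k, [/\ ABC_equation Y (a k) (b k) (c k),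
    ABC_equation Y (b (k - 1)) (c k) (a k) &
    ABC_equation Y (c k) (a (k + 1)) (b k)].
Proof.
move=> oa ob oc a0 b0 c0 abc.
have ha := alpha_orbit_half_turn oa a0.
have hb := alpha_orbit_half_turn ob b0.
have hc := alpha_orbit_half_turn oc c0.
have left k : ABC_equation Y (a k) (b k) (c k) ->
    ABC_equation Y (c k) (a (k + 1)) (b k).
  exact: ABC_move_left (hb k) (hc k) (oa k).
have right k : ABC_equation Y (a k) (b k) (c k) ->
    ABC_equation Y (b (k - 1)) (c k) (a k).
  exact: ABC_move_right (ha k) (hc k) (alpha_orbit_pred ob k).
have all_k : forall k, ABC_equation Y (a k) (b k) (c k).
  elim/int_ind => // m IH.
    rewrite -addn1 PoszD; have := left _ IH.
    move/(ABC_move_left (ha _) (hb _) (oc _)).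
    exact/(ABC_move_left (hc _) (ha _) (ob _)).
  rewrite -addn1 PoszD opprD; have := right _ IH.
  move/(ABC_move_right (hb _) (ha _) (alpha_orbit_pred oc _)).
  exact/(ABC_move_right (hc _) (hb _) (alpha_orbit_pred oa _)).
by move=> k; split; [exact: all_k | exact/right | exact/left].
Qed.

End ABC.

(** * Coherence of the tensors attached to words *)

Section Coherence.
Variables (R : realType) (n : nat) (Y : tens3 R n).
Hypothesis Y_rot : rotation_invariant Y.
Variables A B C : tens4 R n.
Hypothesis ABC_scales : scales Y A B C.

Let orbitA : alpha_orbit (fun k => alpha_pow k A).
Proof. by apply: alpha_pow_orbit => k; have [] := ABC_scales.2 k. Qed.

Let orbitB : alpha_orbit (fun k => alpha_pow k B).
Proof. by apply: alpha_pow_orbit => k; have [] := ABC_scales.2 k. Qed.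

Let orbitC : alpha_orbit (fun k => alpha_pow k C).
Proof. by apply: alpha_pow_orbit => k; have [] := ABC_scales.2 k. Qed.

Lemma scales_ABC_powers :
  quarter_turn (quarter_turn A) = A -> quarter_turn (quarter_turn B) = B ->
  quarter_turn (quarter_turn C) = C -> forall k,
  [/\ ABC_equation Y (alpha_pow k A) (alpha_pow k B) (alpha_pow k C),
    ABC_equation Y (alpha_pow (k - 1) B) (alpha_pow k C) (alpha_pow k A) &
    ABC_equation Y (alpha_pow k C) (alpha_pow (k + 1) A) (alpha_pow k B)].
Proof.
move=> halfA halfB halfC.
exact: (ABC_orbits Y_rot orbitA orbitB orbitC halfA halfB halfC ABC_scales.1).
Qed.

Lemma coherent_Lword_opp :
  quarter_turn (quarter_turn A) = A -> quarter_turn (quarter_turn B) = B ->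
  quarter_turn (quarter_turn C) = C -> coherent Y (Lword_opp A B C).
Proof.
move=> halfA halfB halfC w; rewrite /Lword_opp !foldl_rcons.
by case: (foldl _ _ w) => [[] k]; have [] := scales_ABC_powers halfA halfB halfC k.
Qed.

(** The rule [next_state] uses alpha^(k+1)(B) where the rotated equation has
    alpha^(k-1)(B), and conversely for A; period two identifies them. *)
Lemma coherent_Lword : (forall X : tens4 R n, quarter_turn (quarter_turn X) = X) ->
  coherent Y (Lword A B C).
Proof.
move=> half w; rewrite /Lword !foldl_rcons.
case: (foldl _ _ w) => [[] k]; have [//] := scales_ABC_powers (half A) (half B) (half C) k;
  rewrite /tensor_of_state /=.
(* Only the states A and B shift the exponent. *)
- by rewrite (alpha_orbit_periodic half orbitB).
- by rewrite (alpha_orbit_periodic half orbitA).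
Qed.

End Coherence.

(** * Words with an entry inserted *)

Section Insertion.
Variables (T : Type) (k : nat) (i : 'I_k).

(** The new entry m has position i + 1.  A branching at leaf i keeps position i
    for the left child and inserts the right child just after it. *)
Definition insert_after (v : k.-tuple T) (m : T) : k.+1.-tuple T :=
  [tuple if unlift (lift ord0 i) j is Some j' then tnth v j' else m | j < k.+1].

Definition set_entry (b : T) (v : k.-tuple T) : k.-tuple T :=
  [tuple if j == i then b else tnth v j | j < k].

Lemma insert_after_lift v m j :
  tnth (insert_after v m) (lift (lift ord0 i) j) = tnth v j.
Proof. by rewrite tnth_mktuple liftK. Qed.

Lemma insert_after_new v m : tnth (insert_after v m) (lift ord0 i) = m.
Proof. by rewrite tnth_mktuple unlift_none. Qed.

Lemma insert_after_bij :
  bijective (fun p : k.-tuple T * T => insert_after p.1 p.2).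
Proof.
exists (fun s => ([tuple tnth s (lift (lift ord0 i) j) | j < k],
                  tnth s (lift ord0 i))) => [[v m]|s] /=.
  rewrite insert_after_new; congr (_, _); apply: eq_from_tnth => j.
  by rewrite tnth_mktuple insert_after_lift.
apply: eq_from_tnth => j; rewrite tnth_mktuple.
by case: unliftP => [j' ->|->] //; rewrite tnth_mktuple.
Qed.

(** Substitutes, in the sum over input words s and over the index b that
    replaces s_i, the word actually fed to x and the index it replaced. *)
Lemma swap_entry_involutive :
  involutive (fun p : k.-tuple T * T => (set_entry p.2 p.1, tnth p.1 i)).
Proof.
move=> [v b] /=; congr (_, _); last by rewrite tnth_mktuple eqxx.
apply: eq_from_tnth => j; rewrite !tnth_mktuple.
by case: eqP => [->|].
Qed.

(** The three lemmas on [ordS] say that inserting position i + 1 keeps the cyclic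
    order: the new position comes between i and the former successor of i, which
    is position 0 if i is the last. *)
Lemma ordS_lift_self : ordS (lift (lift ord0 i) i) = lift ord0 i.
Proof.
apply: val_inj; rewrite /= /bump /= add1n ltnn add0n.
by rewrite modn_small // ltnS ltn_ord.
Qed.

Lemma ordS_lift_new : ordS (lift ord0 i) = lift (lift ord0 i) (ordS i).
Proof.
apply: val_inj; rewrite /= /bump /= !add1n.
have := ltn_ord i; rewrite leq_eqVlt => /orP [/eqP e|lt_ik].
  by rewrite e !modnn leqNgt (leq_ltn_trans _ (ltn_ord i)).
by rewrite !modn_small ?ltnS // leqnn.
Qed.

Lemma ordS_lift_neq j : j != i ->
  ordS (lift (lift ord0 i) j) = lift (lift ord0 i) (ordS j).
Proof.
rewrite -val_eqE neq_ltn => /orP ne; apply: val_inj; rewrite /= /bump /= !add1n.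
case: ne => [lt_ji|lt_ij].
  have lt_jk : (j.+1 < k)%N by apply: leq_ltn_trans (ltn_ord i).
  rewrite leqNgt ltnS (ltnW lt_ji) /= add0n.
  rewrite (modn_small lt_jk) modn_small; last by rewrite ltnS ltnW.
  by rewrite ltnS leqNgt lt_ji.
rewrite lt_ij !add1n.
have := ltn_ord j; rewrite leq_eqVlt => /orP [/eqP e|lt_jk].
  by rewrite e !modnn.
by rewrite (modn_small lt_jk) modn_small // ltnS ltnW.
Qed.

Lemma widen_ord_lift : widen_ord (leqnSn k) i = lift (lift ord0 i) i.
Proof. by apply: val_inj; rewrite /= /bump /= add1n ltnn. Qed.

End Insertion.

(** * Sliding the transfer matrix through one branching *)

Section Transfer.
Variables (R : realType) (n : nat) (Y : tens3 R n).

Lemma transferE k (L : k.-tuple (tens4 R n)) x u :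
  transfer L x u = \sum_(s : k.-tuple 'I_n)
    (\sum_(v : k.-tuple 'I_n)
       \prod_(i < k) tnth L i (tnth u i, tnth v (ordS i), tnth s i, tnth v i)) *
    x s.
Proof. by rewrite ffunE. Qed.

Lemma apply_YE k (i : 'I_k) (x : tens R n k) w :
  apply_Y Y i x w = \sum_(b < n)
    Y (b, tnth w (lift (lift ord0 i) i), tnth w (lift ord0 i)) *
    x (set_entry i b [tuple tnth w (lift (lift ord0 i) j) | j < k]).
Proof.
rewrite ffunE widen_ord_lift; apply: eq_bigr => b _; congr (_ * x _).
by apply: eq_from_tnth => j; rewrite !tnth_mktuple.
Qed.

Lemma sum_insert k (i : 'I_k) (F : k.+1.-tuple 'I_n -> R[i]) :
  \sum_s F s = \sum_(v : k.-tuple 'I_n) \sum_m F (insert_after i v m).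
Proof.
rewrite pair_bigA /=; apply: reindex; apply: onW_bij.
exact: insert_after_bij.
Qed.

Lemma sum_swap_entry k (i : 'I_k) (F : k.-tuple 'I_n -> 'I_n -> R[i]) :
  \sum_s \sum_b F s b =
  \sum_(s : k.-tuple 'I_n) \sum_b F (set_entry i b s) (tnth s i).
Proof.
rewrite !pair_bigA /=.
by rewrite (reindex_inj (inv_inj (@swap_entry_involutive _ k i))).
Qed.

(** Coherence is used at a single place.  On the left, the indices y and m inserted
    in the input word and in the bonds, together with the index c that Y
    produces at position i, occur only in the two tensors at i and i + 1 and in
    Y; their sum is an entry of D.  On the right the corresponding factor is an
    entry of Y(L_i), and all the other factors agree. *)
Lemma transfer_branch k (i : 'I_k) (L : k.-tuple (tens4 R n))
    (L' : k.+1.-tuple (tens4 R n)) (x : tens R n k) :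
  (forall j, j != i -> tnth L' (lift (lift ord0 i) j) = tnth L j) ->
  ABC_equation Y (tnth L' (lift (lift ord0 i) i)) (tnth L' (lift ord0 i))
    (tnth L i) ->
  transfer L' (apply_Y Y i x) = apply_Y Y i (transfer L x).
Proof.
move=> L'neq /ABC_entries abc; apply/ffunP => u.
rewrite transferE apply_YE.
set h := lift ord0 i in L'neq abc *.
set A := tnth L' (lift h i) in abc; set B := tnth L' h in abc.
set u0 := tnth u (lift h i); set u1 := tnth u h.
(* The factors at leaves other than i, common to both sides. *)
pose rest (s v : k.-tuple 'I_n) := \prod_(j < k | j != i)
  tnth L j (tnth u (lift h j), tnth v (ordS j), tnth s j, tnth v j).
have prodL' s y v m :
    \prod_(j < k.+1) tnth L' j (tnth u j, tnth (insert_after i v m) (ordS j),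
      tnth (insert_after i s y) j, tnth (insert_after i v m) j) =
    A (u0, m, tnth s i, tnth v i) * B (u1, tnth v (ordS i), y, m) * rest s v.
  rewrite (bigD1_ord h) //= (bigD1 i) //= mulrA; congr (_ * _).
    rewrite ordS_lift_self ordS_lift_new !insert_after_lift !insert_after_new.
    by rewrite mulrC.
  apply: eq_bigr => j ji.
  by rewrite L'neq // ordS_lift_neq // !insert_after_lift.
have prodL b s v :
    \prod_(j < k) tnth L j (tnth (set_entry i b
        [tuple tnth u (lift h j) | j < k]) j,
      tnth v (ordS j), tnth s j, tnth v j) =
    tnth L i (b, tnth v (ordS i), tnth s i, tnth v i) * rest s v.
  rewrite (bigD1 i) //= tnth_mktuple eqxx; congr (_ * _).
  by apply: eq_bigr => j /negPf ji; rewrite !tnth_mktuple ji.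
have rest_set b s v : rest (set_entry i b s) v = rest s v.
  by apply: eq_bigr => j /negPf ji; rewrite tnth_mktuple ji.
transitivity (\sum_(s : k.-tuple 'I_n) \sum_(v : k.-tuple 'I_n)
    rest s v * x s * \sum_c \sum_y \sum_m
      Y (tnth s i, c, y) * A (u0, m, c, tnth v i) *
      B (u1, tnth v (ordS i), y, m)).
  (* Split off the new input index y and the new bond m. *)
  rewrite (sum_insert i).
  under eq_bigr => s _.
    under eq_bigr => y _.
      rewrite (sum_insert i) apply_YE mulr_sumr.
      under eq_bigr => b _.
        rewrite insert_after_lift insert_after_new.
        have -> : [tuple tnth (insert_after i s y) (lift (lift ord0 i) j) | j < k]
            = s.
          by apply: eq_from_tnth => j; rewrite tnth_mktuple insert_after_lift.
        under eq_bigr => v _ do under eq_bigr => m _ do rewrite prodL'.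
        over.
      over.
    rewrite exchange_big.
    over.
  (* Sum over the word fed to x instead of the one Y has branched. *)
  rewrite /= (sum_swap_entry i); apply: eq_bigr => s _.
  under [LHS]eq_bigr => c _.
    under eq_bigr => y _.
      rewrite tnth_mktuple eqxx.
      have -> : set_entry i (tnth s i) (set_entry i c s) = s.
        by have [] := swap_entry_involutive i (s, c).
      rewrite mulr_suml.
      under eq_bigr => v _ do rewrite mulr_suml.
      over.
    rewrite exchange_big.
    over.
  rewrite [LHS]exchange_big; apply: eq_bigr => v _ /=.
  rewrite mulr_sumr; apply: eq_bigr => c _.
  rewrite mulr_sumr; apply: eq_bigr => y _.
  rewrite mulr_sumr; apply: eq_bigr => m _.
  by rewrite rest_set; ring.
under eq_bigr => s _ do under eq_bigr => v _ do rewrite abc mulr_sumr.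
under [RHS]eq_bigr => b _.
  rewrite transferE mulr_sumr.
  under eq_bigr => s _ do rewrite mulr_suml mulr_sumr.
  over.
rewrite [RHS]exchange_big; apply: eq_bigr => s _ /=.
rewrite [RHS]exchange_big; apply: eq_bigr => v _ /=.
by apply: eq_bigr => p _; rewrite prodL; ring.
Qed.

Lemma transfer_cast k l (e : k = l) (L : l.-tuple (tens4 R n)) (x : tens R n k) :
  transfer L (cast_tens e x) = cast_tens e (transfer (tcast (esym e) L) x).
Proof.
case: l / e L => L.
have cast_id (z : tens R n k) : cast_tens erefl z = z.
  by apply/ffunP => w; rewrite ffunE tcast_id.
by rewrite !cast_id tcast_id.
Qed.

End Transfer.

(** * Branching a tree, and the theorem *)

Lemma leaf_words_branch (t : tree) (i : nat) : (i < nleaves t)%N ->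
  let w := nth [::] (leaf_words t) i in
  leaf_words (branch t i) = take i (leaf_words t) ++
    [:: rcons w false; rcons w true] ++ drop i.+1 (leaf_words t).
Proof.
elim: t i => [|l IHl r IHr] i /=; first by case: i.
rewrite nleaves_node => lt_i; rewrite nth_cat take_cat drop_cat size_map.
rewrite -/(nleaves l); case: ltnP => [lt_il | le_li] /=.
  rewrite IHl //= !map_cat /= map_take map_drop -catA /= (nth_map [::]) //=.
  case: ltnP => //= le_li; congr (_ ++ [:: _, _ & _]).
  rewrite [drop _ (map _ _)]drop_oversize ?size_map //.
  by rewrite (eqP (_ : i.+1 - _ == 0)%N) ?drop0 ?subn_eq0.
have lt_ir : (i - nleaves l < nleaves r)%N by rewrite ltn_subLR.
rewrite IHr //= !map_cat /= map_take map_drop -catA /= (nth_map [::]) //=.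
by rewrite ltnNge ltnW ?ltnS //= subSn.
Qed.

Lemma leaf_words_branch_lift (t : tree) (i j : nat) : (i < nleaves t)%N -> j != i ->
  nth [::] (leaf_words (branch t i)) (bump i.+1 j) = nth [::] (leaf_words t) j.
Proof.
move=> lt_it; have le_it := ltnW lt_it.
rewrite neq_ltn => /orP ji; rewrite leaf_words_branch // /bump nth_cat size_takel //.
case: ji => [lt_ji|lt_ij].
  by rewrite (leq_gtF (ltnW lt_ji)) lt_ji nth_take.
rewrite lt_ij add1n ltnNge ltnW ?leqW //= subSn 1?ltnW // -(subnSK lt_ij) /=.
by rewrite nth_drop subnKC.
Qed.

Lemma leaf_words_branch_children (t : tree) (i : nat) : (i < nleaves t)%N ->
  let w := nth [::] (leaf_words t) i in
  nth [::] (leaf_words (branch t i)) i = rcons w false /\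
  nth [::] (leaf_words (branch t i)) i.+1 = rcons w true.
Proof.
move=> lt_it /=; have le_it := ltnW lt_it.
rewrite leaf_words_branch // !nth_cat size_takel //.
by rewrite ltnn subnn (leq_gtF (leqnSn i)) subSnn.
Qed.

(** Every connecting map is a composite of single branchings, so induction along
    them reduces the claim to [transfer_branch]; a branching at leaf i replaces
    its word w by the consecutive words w0 and w1. *)
Lemma coherent_scale_invariant (R : realType) (n : nat) (Y : tens3 R n)
    (L : word -> tens4 R n) : coherent Y L -> scale_invariant Y L.
Proof.
move=> cohL s t _ f; elim=> // {}t {}f i _ IH x.
rewrite -IH /transfer_tree /iota_branch transfer_cast; congr cast_tens.
set L' := tcast _ _.
have L'E (j : 'I_(nleaves t).+1) :
    tnth L' j = L (nth [::] (leaf_words (branch t i)) j).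
  rewrite (tnth_nth (L [::])) val_tcast /= (nth_map [::]) //.
  by rewrite -/(nleaves _) nleaves_branch.
have LE (j : 'I_(nleaves t)) :
    tnth (map_tuple L (in_tuple (leaf_words t))) j = L (nth [::] (leaf_words t) j).
  by rewrite tnth_map (tnth_nth [::]).
have [w0 w1] := leaf_words_branch_children (ltn_ord i).
apply: transfer_branch => [j ji|].
  rewrite L'E LE; congr L; exact: leaf_words_branch_lift.
rewrite !L'E LE.
rewrite -widen_ord_lift /= w0 /bump add1n w1; exact: cohL.
Qed.

Theorem theorem2p21 (R : realType) (n : nat) (Y : tens3 R n)
    (hY_isometry : isometry_Y Y) (hY_rotation : rotation_invariant Y)
    (A B C : tens4 R n) (h_scales : scales Y A B C) :
  ((forall X : tens4 R n, quarter_turn (quarter_turn X) = X) ->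
     coherent Y (Lword A B C) /\ scale_invariant Y (Lword A B C)) /\
  (quarter_turn (quarter_turn A) = A ->
   quarter_turn (quarter_turn B) = B ->
   quarter_turn (quarter_turn C) = C ->
     coherent Y (Lword_opp A B C) /\ scale_invariant Y (Lword_opp A B C)).
Proof.
split=> [half | halfA halfB halfC].
  have cohL := coherent_Lword hY_rotation h_scales half.
  by split=> //; apply: coherent_scale_invariant.
have cohL := coherent_Lword_opp hY_rotation h_scales halfA halfB halfC.
by split=> //; apply: coherent_scale_invariant.
Qed.
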